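(* Let $X$ be an Abelian group equipped with a binary relation $\perp$ such that (i) if $x,y\in X$ and $x\perp y$, then $x\perp -y$, $-x\perp y$ and $2x\perp 2y$; and (ii) for every $x\in X$ there exists $y\in X$ such that $x\perp y$ and $x+y\perp x-y$. Let $\beta_2>0$ and let $Y$ be a $\beta_2$-homogeneous $F$-space with $F$-norm $\|\cdot\|$. Let $\varepsilon\ge 0$ and let $f:X\to Y$ be a mapping such that for all $x,y\in X$, $$x\perp y \quad\text{implies}\quad \|f(x+y)-f(x)-f(y)\|\le \varepsilon .$$ Then there exists a mapping $g:X\to Y$ such that for all $x,y\in X$, $$x\perp y\quad\text{implies}\quad g(x+y)=g(x)+g(y),$$ and $$\|f(x)-g(x)\|\le b\,\varepsilon\qquad\text{for all } x\in 2X=\{2x: x\in X\},$$ where $$b=\frac{2^{\beta_2+2}+3^{\beta_2+1}+3}{8^{\beta_2}}\left(1+\sum_{n=2}^{\infty}\left(\left(\frac{2^{n-1}+1}{2\cdot 4^{n-1}}\right)^{\beta_2}+\left(\frac{2^{n-1}-1}{2\cdot 4^{n-1}}\right)^{\beta_2}\right)\right).$$ Moreover, $g$ is unique on the set $2X$: any two mappings $X\to Y$ satisfying both of these conditions coincide on $2X$.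
   Context: Let $Y$ be a (real or complex) linear space. A non-negative valued function $\|\cdot\|$ on $Y$ is an $F$-norm if: (1) $\|x\|=0$ if and only if $x=0$; (2) $\|\lambda x\|=\|x\|$ for all $x$ and all scalars $\lambda$ with $|\lambda|=1$; (3) $\|x+y\|\le\|x\|+\|y\|$ for all $x,y$; (4) $\|\lambda_n x\|\to 0$ whenever $\lambda_n\to 0$; (5) $\|\lambda x_n\|\to 0$ whenever $x_n\to 0$ (i.e. $\|x_n\|\to 0$); (6) $\|\lambda_n x_n\|\to 0$ whenever $\lambda_n\to 0$ and $x_n\to 0$. An $F$-space is a linear space with an $F$-norm that is complete with respect to the metric $d(x,y)=\|x-y\|$. For $\beta>0$, the $F$-norm (and the $F$-space) is called $\beta$-homogeneous if $\|tx\|=|t|^{\beta}\|x\|$ for all $x$ and all scalars $t$. *)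

(* Defs.v *)
From mathcomp Require Import all_boot all_order all_algebra.
From mathcomp Require Import all_classical all_reals all_analysis.
From mathcomp Require Import complex.
Set Implicit Arguments.
Unset Strict Implicit.
Unset Printing Implicit Defensive.
Import Order.TTheory GRing.Theory Num.Theory.
Import numFieldNormedType.Exports.
Local Open Scope classical_set_scope.
Local Open Scope ring_scope.

(* An F-space may be real or complex, whereas its F-norm is always real-valued.
   The norm `|_| of R[i] takes its values in R[i], hence the separate R-valued
   modulus scalar_abs. *)
Inductive scalar_kind := RealScalars | ComplexScalars.

Definition scalars (R : realType) (k : scalar_kind) : numFieldType :=
  match k with
  | RealScalars => R
  | ComplexScalars => R[i]
  end.

Definition scalar_abs (R : realType) (k : scalar_kind) : scalars R k -> R :=
  match k return scalars R k -> R with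
  | RealScalars => fun t : R => `|t|
  | ComplexScalars => fun t : R[i] => ComplexField.Normc.normc t
  end.

Section FSpace.
Variables (R : realType) (k : scalar_kind) (Y : lmodType (scalars R k)).
Implicit Types nrm : Y -> R.

Record is_Fnorm nrm : Prop := IsFnorm {
  Fnorm_ge0 : forall x, 0 <= nrm x;
  Fnorm_eq0 : forall x, nrm x = 0 <-> x = 0;
  Fnorm_unit : forall (t : scalars R k) x,
    scalar_abs t = 1 -> nrm (t *: x) = nrm x;
  Fnorm_triangle : forall x y, nrm (x + y) <= nrm x + nrm y;
  Fnorm_cvg_scalar : forall (t : nat -> scalars R k) x,
    scalar_abs (t n) @[n --> \oo] --> (0 : R) ->
    nrm (t n *: x) @[n --> \oo] --> (0 : R);
  Fnorm_cvg_vector : forall (t : scalars R k) (x : nat -> Y),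
    nrm (x n) @[n --> \oo] --> (0 : R) ->
    nrm (t *: x n) @[n --> \oo] --> (0 : R);
  Fnorm_cvg_both : forall (t : nat -> scalars R k) (x : nat -> Y),
    scalar_abs (t n) @[n --> \oo] --> (0 : R) ->
    nrm (x n) @[n --> \oo] --> (0 : R) ->
    nrm (t n *: x n) @[n --> \oo] --> (0 : R)
}.

Definition Fcauchy nrm (x : nat -> Y) : Prop :=
  forall e : R, 0 < e -> exists N : nat, forall m n : nat,
    (N <= m)%N -> (N <= n)%N -> nrm (x m - x n) < e.

Definition Fcomplete nrm : Prop :=
  forall x : nat -> Y, Fcauchy nrm x ->
    exists l : Y, nrm (x n - l) @[n --> \oo] --> (0 : R).

Definition is_Fspace nrm : Prop := is_Fnorm nrm /\ Fcomplete nrm.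

Definition homogeneous_Fnorm (beta : R) nrm : Prop :=
  forall (t : scalars R k) x, nrm (t *: x) = scalar_abs t `^ beta * nrm x.

End FSpace.

Definition orthogonality_axioms (X : zmodType) (perp : X -> X -> Prop) : Prop :=
  (forall x y, perp x y ->
     [/\ perp x (- y), perp (- x) y & perp (x *+ 2) (y *+ 2)]) /\
  (forall x, exists y, perp x y /\ perp (x + y) (x - y)).

Definition orth_additive (X Y : zmodType) (perp : X -> X -> Prop) (g : X -> Y)
  : Prop :=
  forall x y, perp x y -> g (x + y) = g x + g y.

Definition double_set (X : zmodType) : set X := [set x *+ 2 | x in [set: X]].
Arguments double_set : clear implicits.

(* For 0 < beta the terms are nonnegative and O((2 `^ beta)^-n), so the series
   converges and the limit below is its genuine sum. *)
Definition stability_const (R : realType) (beta : R) : R :=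
  (2 `^ (beta + 2) + 3 `^ (beta + 1) + 3) / 8 `^ beta *
  (1 + \big[+%R/0]_(2 <= n <oo)
         (((2 ^+ n.-1 + 1) / (2 * 4 ^+ n.-1)) `^ beta +
          ((2 ^+ n.-1 - 1) / (2 * 4 ^+ n.-1)) `^ beta)).

(* Main.v *)
Require Import Defs.
From mathcomp Require Import all_boot all_order all_algebra.
From mathcomp Require Import all_classical all_reals all_analysis.
From mathcomp Require Import complex.
From mathcomp Require Import ring.
Set Implicit Arguments.
Unset Strict Implicit.
Unset Printing Implicit Defensive.
Import Order.TTheory GRing.Theory Num.Theory.
Import numFieldNormedType.Exports.
Local Open Scope classical_set_scope.
Local Open Scope ring_scope.

(** Call (x, y) a diagonal pair when x is orthogonal to y and x + y to x - y.
    For such a pair, additivity along orthogonal vectors gives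
    f (2x) = 2 f x + f y + f (- y), and the even parts of f at 2x and 2y agree;
    replacing f by an approximately additive map, these become approximate
    equations (close_double, close_even_part). Every x has a y completing a
    diagonal pair, and (2x, 2y) is again one, so at w = 2x both equations are
    available. They combine into 8 f w = 3 f (2w) - f (- 2w), with an error of at
    most (4 2^beta + 3 3^beta + 3) eps (nrm_doubling_defect). Equivalently, along
    doubling the odd part of f on 2X is almost additive and its even part almost
    quadratic.

    This suggests a Hyers-type limit with one rescaling for each part: g x is
    the limit of renorm f n x = a_n f (2^n x) - b_n f (- 2^n x), where
    a_n = (2^n + 1) / (2 4^n) and b_n = (2^n - 1) / (2 4^n). Two consecutive
    terms differ by a_n / 8 and - b_n / 8 times the defects at 2^n x and - 2^n x
    (renorm_step). By homogeneity the n-th step has size at most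
    (a_n^beta + b_n^beta) times a constant, which is summable since both weights
    are at most 2^-n; summing the steps yields exactly the stability constant
    (stability_constE, nrm_dist_renorm). The limit is orthogonally additive
    because the deviation of renorm f n from additivity is at most
    (a_n^beta + b_n^beta) eps.

    For uniqueness, the same estimate with eps = 0 shows that an orthogonally
    additive map is fixed by renorm on 2X (orth_additive_renorm). Two solutions
    are at bounded distance there, and renorm contracts this distance to 0. *)

(** * The renormalization weights and their series *)

(** The weights of f (2^n x) and of f (- 2^n x) in the n-th renormalized map:
    even_weight is half the sum and odd_weight half the difference of 1 / 2^n
    and 1 / 4^n. They are defined over any number field because they occur both
    as scalars acting on Y and, after taking moduli, as real numbers. *)
Definition even_weight (F : numFieldType) n : F := (2 ^+ n + 1) / (2 * 4 ^+ n).
Definition odd_weight (F : numFieldType) n : F := (2 ^+ n - 1) / (2 * 4 ^+ n).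

Section Weights.
Variable F : numFieldType.

Lemma four_expE n : 4 ^+ n = (2 ^+ n) ^+ 2 :> F.
Proof. by rewrite -exprM mulnC exprM; congr (_ ^+ n); ring. Qed.

Lemma even_weight0 : even_weight F 0 = 1.
Proof. by rewrite /even_weight !expr0; field. Qed.

Lemma odd_weight0 : odd_weight F 0 = 0.
Proof. by rewrite /odd_weight !expr0 subrr mul0r. Qed.

Lemma even_weightS n :
  even_weight F n.+1 = 3 / 8 * even_weight F n + 1 / 8 * odd_weight F n.
Proof.
have four_neq0 : 4 ^+ n != 0 :> F by rewrite expf_neq0.
by rewrite /even_weight /odd_weight !exprS; field.
Qed.

Lemma odd_weightS n :
  odd_weight F n.+1 = 1 / 8 * even_weight F n + 3 / 8 * odd_weight F n.
Proof.
have four_neq0 : 4 ^+ n != 0 :> F by rewrite expf_neq0.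
by rewrite /even_weight /odd_weight !exprS; field.
Qed.

(** As quotients of natural numbers the weights are nonnegative, and their
    moduli are the same quotients, be the scalars real or complex. *)
Lemma even_weight_nat n :
  even_weight F n = (2 ^ n + 1)%:R / (2 * 4 ^ n)%:R.
Proof. by rewrite /even_weight natrD natrM !natrX. Qed.

Lemma odd_weight_nat n :
  odd_weight F n = (2 ^ n - 1)%:R / (2 * 4 ^ n)%:R.
Proof. by rewrite /odd_weight natrB ?expn_gt0// natrM !natrX. Qed.

Lemma even_weight_ge0 n : 0 <= even_weight F n.
Proof. by rewrite even_weight_nat divr_ge0. Qed.

Lemma odd_weight_ge0 n : 0 <= odd_weight F n.
Proof. by rewrite odd_weight_nat divr_ge0. Qed.

Lemma odd_weight_le_even n : odd_weight F n <= even_weight F n.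
Proof.
rewrite odd_weight_nat even_weight_nat.
rewrite ler_pM2r ?invr_gt0 ?ltr0n ?muln_gt0 ?expn_gt0//.
by rewrite ler_nat leq_subLR addnC -addnA leq_addr.
Qed.

Lemma even_weight_le n : even_weight F n <= 2^-1 ^+ n.
Proof.
rewrite /even_weight four_expE ler_pdivrMr; last first.
  by rewrite mulr_gt0// !exprn_gt0.
have -> : 2^-1 ^+ n * (2 * (2 ^+ n) ^+ 2) = 2 ^+ n + 2 ^+ n :> F.
  by rewrite exprVn; field; rewrite expf_neq0.
by rewrite lerD2l -natrX ler1n expn_gt0.
Qed.

End Weights.

(** * Moduli of real and complex scalars *)

Section ScalarAbs.
Variables (R : realType) (k : scalar_kind).

Lemma scalar_absM (s t : scalars R k) :
  scalar_abs (s * t) = scalar_abs s * scalar_abs t.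
Proof.
by case: k s t => s t /=; [exact: normrM|exact: ComplexField.Normc.normcM].
Qed.

Lemma scalar_abs_natr n : scalar_abs (n%:R : scalars R k) = n%:R.
Proof.
case: k => /=; first exact: normr_nat.
by rewrite normcMn ComplexField.Normc.normc1.
Qed.

Lemma scalar_absV (t : scalars R k) : scalar_abs t^-1 = (scalar_abs t)^-1.
Proof.
by case: k t => t /=; [exact: normfV|exact: ComplexField.Normc.normcV].
Qed.

Lemma scalar_absN1 : scalar_abs (- 1 : scalars R k) = 1.
Proof.
case: k => /=; first by rewrite normrN1.
exact: etrans (normcN (1 : R[i])) (ComplexField.Normc.normc1 _).
Qed.

Lemma scalar_abs_even_weight n :
  scalar_abs (even_weight (scalars R k) n) = even_weight R n.
Proof. by rewrite !even_weight_nat scalar_absM scalar_absV !scalar_abs_natr. Qed.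

Lemma scalar_abs_odd_weight n :
  scalar_abs (odd_weight (scalars R k) n) = odd_weight R n.
Proof. by rewrite !odd_weight_nat scalar_absM scalar_absV !scalar_abs_natr. Qed.

End ScalarAbs.

(** * The stability constant as a sum of weights *)

Section WeightSeries.
Variables (R : realType) (beta : R).
Hypothesis beta_gt0 : 0 < beta.

Definition weight_term n : R :=
  even_weight R n `^ beta + odd_weight R n `^ beta.

Lemma weight_term_ge0 n : 0 <= weight_term n.
Proof. by rewrite addr_ge0 ?powR_ge0. Qed.

Lemma weight_term0 : weight_term 0 = 1.
Proof.
by rewrite /weight_term even_weight0 odd_weight0 powR1 powR0 ?addr0 ?gt_eqF.
Qed.

(** Both weights are at most 1 / 2^n, so the terms are dominated by a geometric
    sequence of ratio (1/2)^beta, which is less than 1 for beta > 0. *)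
Lemma weight_term_le n : weight_term n <= 2 * (2^-1 `^ beta) ^+ n.
Proof.
have le (t : R) : 0 <= t -> t <= 2^-1 ^+ n -> t `^ beta <= (2^-1 `^ beta) ^+ n.
  move=> t0 tn; rewrite -powR_mulrn ?powR_ge0// -powRrM mulrC powRrM.
  rewrite powR_mulrn ?invr_ge0//.
  by rewrite (ge0_ler_powR (ltW beta_gt0))// nnegrE exprn_ge0// invr_ge0.
have ew := even_weight_le R n.
rewrite mulrDl mul1r lerD ?le ?even_weight_ge0 ?odd_weight_ge0//.
exact: le_trans (odd_weight_le_even R n) ew.
Qed.

Lemma half_powR_lt1 : `|2^-1 `^ beta : R| < 1.
Proof.
have one : 1 `^ beta = 1 :> R by rewrite powR1.
rewrite ger0_norm ?powR_ge0// -[ltRHS]one.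
rewrite gt0_ltr_powR ?nnegrE ?invr_ge0// invf_lt1//.
by rewrite (ltr_nat R 1 2).
Qed.

Lemma cvg_weight_term : weight_term n @[n --> \oo] --> (0 : R).
Proof.
apply: (@squeeze_cvgr _ _ _ _ (fun=> 0) (geometric 2 (2^-1 `^ beta))).
- by apply: nearW => n; rewrite weight_term_ge0 weight_term_le.
- exact: cvg_cst.
- exact/cvg_geometric/half_powR_lt1.
Qed.

Lemma cvg_weight_termM M : weight_term n * M @[n --> \oo] --> (0 : R).
Proof.
by rewrite -(mul0r M); apply: cvgM; [exact: cvg_weight_term|exact: cvg_cst].
Qed.

Lemma is_cvg_weight_series : cvgn (series weight_term).
Proof.
apply: (@series_le_cvg _ _ (geometric 2 (2^-1 `^ beta))).
- exact: weight_term_ge0.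
- by move=> n; rewrite mulr_ge0 ?exprn_ge0 ?powR_ge0.
- exact: weight_term_le.
- exact/is_cvg_geometric_series/half_powR_lt1.
Qed.

Lemma weight_series_nd : nondecreasing_seq (series weight_term).
Proof.
apply/nondecreasing_seqP => n.
by rewrite -subr_ge0 seriesSB weight_term_ge0.
Qed.

Definition defect_const : R := 2 `^ (beta + 2) + 3 `^ (beta + 1) + 3.

Lemma defect_const_ge0 : 0 <= defect_const.
Proof. by rewrite !addr_ge0 ?powR_ge0. Qed.

Lemma defect_constE :
  defect_const = 4 * 2 `^ beta + 3 * 3 `^ beta + 3.
Proof.
rewrite /defect_const !powRD ?pnatr_eq0 ?implybT//.
by rewrite !powRr1//; ring.
Qed.

(** The leading 1 in the definition of the stability constant is the term of
    index 0, and the remaining terms are shifted by one. *)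
Lemma stability_constE :
  stability_const beta = defect_const / 8 `^ beta * limn (series weight_term).
Proof.
rewrite /stability_const; congr (_ * _).
pose tail m := \sum_(2 <= n < m) weight_term n.-1.
have tailE m : series weight_term m.+1 = 1 + tail m.+2.
  rewrite /series /tail /= big_ltn// weight_term0; congr (_ + _).
  by rewrite [RHS]big_add1.
have tail_cvg : tail n @[n --> \oo] --> limn (series weight_term) - 1.
  rewrite -(cvg_shiftn 2) /=.
  have -> : (fun n => tail (n + 2)%N) =
            (fun n => series weight_term (n + 1)%N - 1).
    by apply/funext => n; rewrite addn1 tailE addn2 addrC addKr.
  apply: cvgB; last exact: cvg_cst.
  by rewrite (cvg_shiftn 1); exact: is_cvg_weight_series.
by rewrite (cvg_lim _ tail_cvg)// addrC subrK.
Qed.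

End WeightSeries.

(** * The renormalized maps *)

Section Renormalization.
Variables (F : numFieldType) (X : zmodType) (Y : lmodType F).
Implicit Types f g : X -> Y.

(** Vanishes when, along doubling, the even part of f is quadratic and its odd
    part additive: then f (2w) = 4e + 2o and f (- 2w) = 4e - 2o where f w = e + o. *)
Definition doubling_defect f w : Y :=
  f w *+ 8 - f (w *+ 2) *+ 3 + f (- (w *+ 2)).

(** Equals (4^-n (f z + f (- z)) + 2^-n (f z - f (- z))) / 2 with z = 2^n x: the
    even part is rescaled quadratically, the odd part linearly. *)
Definition renorm f n x : Y :=
  even_weight F n *: f (x *+ 2 ^ n) - odd_weight F n *: f (- (x *+ 2 ^ n)).

Lemma renorm0 f x : renorm f 0 x = f x.
Proof. by rewrite /renorm even_weight0 odd_weight0 scale1r scale0r subr0. Qed.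

(** The weights of order n+1 are combinations of those of order n with
    coefficients 3/8 and 1/8, so consecutive renormalizations differ by
    multiples of the doubling defects at 2^n x and - 2^n x alone. *)
Lemma renorm_step f n x :
  renorm f n x - renorm f n.+1 x =
  even_weight F n *: (8^-1 *: doubling_defect f (x *+ 2 ^ n)) -
  odd_weight F n *: (8^-1 *: doubling_defect f (- (x *+ 2 ^ n))).
Proof.
rewrite /renorm even_weightS odd_weightS expnSr mulrnA.
rewrite /doubling_defect mulNrn opprK.
move: (f _) (f _) (f _) (f _) => A B C D.
set e := even_weight F n; set o := odd_weight F n.
have expand (U V W : Y) : 8^-1 *: (U *+ 8 - V *+ 3 + W) =
    U - (3 / 8) *: V + (1 / 8) *: W.
  rewrite scalerDr scalerBr -[U *+ 8]scaler_nat -[V *+ 3]scaler_nat 2!scalerA.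
  rewrite mulVf ?pnatr_eq0// scale1r.
  by rewrite mul1r (mulrC _ 3).
rewrite !expand !(scalerDr, scalerN, scalerA, scalerDl).
rewrite !(mulrC e) !(mulrC o).
rewrite !(opprD, opprK) !addrA.
by rewrite [LHS](ACl (1 * 3 * 5 * 2 * 6 * 4)).
Qed.

Lemma renormB f g n x :
  renorm f n x - renorm g n x =
  even_weight F n *: (f (x *+ 2 ^ n) - g (x *+ 2 ^ n)) -
  odd_weight F n *: (f (- (x *+ 2 ^ n)) - g (- (x *+ 2 ^ n))).
Proof. by rewrite /renorm !scalerBr !opprD addrACA. Qed.

Lemma renorm_cauchy_diff f n x y :
  let a := x *+ 2 ^ n in let b := y *+ 2 ^ n in
  renorm f n (x + y) - renorm f n x - renorm f n y =
  even_weight F n *: (f (a + b) - f a - f b) -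
  odd_weight F n *: (f (- a - b) - f (- a) - f (- b)).
Proof.
move=> a b; rewrite /renorm mulrnDl opprD -/a -/b !scalerBr !opprD !opprK.
by rewrite !addrA [LHS](ACl (1 * 3 * 5 * 2 * 4 * 6)).
Qed.

End Renormalization.

(** * Approximate equality in a homogeneous F-norm *)

Section HomogeneousFnorm.
Variables (R : realType) (k : scalar_kind) (Y : lmodType (scalars R k)).
Variables (nrm : Y -> R) (beta : R).
Hypotheses (nrm_Fnorm : is_Fnorm nrm) (nrm_hom : homogeneous_Fnorm beta nrm).
Implicit Types (u v w : Y) (d e M : R).

Let nrm_ge0 u : 0 <= nrm u. Proof. exact: Fnorm_ge0. Qed.
Let nrmD u v : nrm (u + v) <= nrm u + nrm v. Proof. exact: Fnorm_triangle. Qed.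

Lemma nrm0 : nrm 0 = 0. Proof. exact/(Fnorm_eq0 nrm_Fnorm). Qed.

Lemma nrm_eq0 u : nrm u = 0 -> u = 0. Proof. by move/(Fnorm_eq0 nrm_Fnorm). Qed.

Lemma nrmN u : nrm (- u) = nrm u.
Proof. by rewrite -scaleN1r (Fnorm_unit nrm_Fnorm)// scalar_absN1. Qed.

Lemma nrm_distC u v : nrm (u - v) = nrm (v - u).
Proof. by rewrite -nrmN opprB. Qed.

Lemma nrmMn u n : nrm (u *+ n) = n%:R `^ beta * nrm u.
Proof. by rewrite -scaler_nat nrm_hom scalar_abs_natr. Qed.

Lemma nrm_weights n u v M : nrm u <= M -> nrm v <= M ->
  nrm (even_weight _ n *: u - odd_weight _ n *: v) <= weight_term beta n * M.
Proof.
move=> uM vM; apply: le_trans (nrmD _ _) _; rewrite nrmN !nrm_hom.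
rewrite scalar_abs_even_weight scalar_abs_odd_weight mulrDl.
by rewrite lerD// ler_wpM2l// powR_ge0.
Qed.

(** Approximate equality as a relation, so that the estimates below can be
    chained and added like equations with the errors accumulating. *)
Definition close d u v := nrm (u - v) <= d.

Lemma close_refl u : close 0 u u.
Proof. by rewrite /close subrr nrm0. Qed.

Lemma close_sym d u v : close d u v -> close d v u.
Proof. by rewrite /close nrm_distC. Qed.

Lemma close_trans v d e u w : close d u v -> close e v w -> close (d + e) u w.
Proof.
move=> uv vw; rewrite /close -(subrKA v).
exact: le_trans (nrmD _ _) (lerD uv vw).
Qed.

Lemma closeD d e u u' v v' :
  close d u v -> close e u' v' -> close (d + e) (u + u') (v + v').
Proof.
move=> uv uv'; rewrite /close opprD addrACA.
exact: le_trans (nrmD _ _) (lerD uv uv').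
Qed.

Lemma closeMn d u v n :
  close d u v -> close (n%:R `^ beta * d) (u *+ n) (v *+ n).
Proof. by move=> uv; rewrite /close -mulrnBl nrmMn ler_wpM2l ?powR_ge0. Qed.

(** * The doubling defect of an approximately orthogonally additive map *)

Section ApproximatelyAdditive.
Variables (X : zmodType) (perp : X -> X -> Prop) (f : X -> Y) (eps : R).
Hypothesis perpP : orthogonality_axioms perp.
Hypothesis f_add : forall x y, perp x y -> nrm (f (x + y) - f x - f y) <= eps.

Lemma perpNr x y : perp x y -> perp x (- y).
Proof. by case/perpP.1. Qed.

Lemma perpNl x y : perp x y -> perp (- x) y.
Proof. by case/perpP.1. Qed.

Lemma perp_double n x y : perp x y -> perp (x *+ 2 ^ n) (y *+ 2 ^ n).
Proof.
elim: n => [//|n IHn] /IHn /perpP.1[_ _].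
by rewrite expnSr !mulrnA.
Qed.

(** Adjacent sides x and y of a figure like a square: 2x and 2y are then sums of
    orthogonal diagonals. *)
Definition diagonal_pair x y := perp x y /\ perp (x + y) (x - y).

Lemma diagonal_pairN x y : diagonal_pair x y -> diagonal_pair (- x) (- y).
Proof.
case=> xy pq; split; first exact/perpNl/perpNr.
by rewrite -!opprD; apply/perpNl/perpNr.
Qed.

Lemma diagonal_pair_double x y :
  diagonal_pair x y -> diagonal_pair (x *+ 2) (y *+ 2).
Proof.
case=> /(perp_double 1) xy /(perp_double 1) pq; split => //.
by rewrite -mulrnDl -mulrnBl.
Qed.

Lemma close_orth x y : perp x y -> close eps (f (x + y)) (f x + f y).
Proof. by move=> /f_add; rewrite /close opprD addrA. Qed.

Lemma close_orthB x y : perp x y -> close eps (f (x - y)) (f x + f (- y)).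
Proof. by move=> /perpNr/close_orth. Qed.

Lemma double_eq (x y : X) : x *+ 2 = (x + y) + (x - y).
Proof. by rewrite addrACA subrr addr0 mulr2n. Qed.

(** Orthogonal additivity is used once on the diagonals, 2x = (x + y) + (x - y),
    and once on each of them. *)
Lemma close_double x y : diagonal_pair x y ->
  close (3 * eps) (f (x *+ 2)) (f x *+ 2 + (f y + f (- y))).
Proof.
case=> xy pq; have -> : 3 * eps = eps + (eps + eps) by ring.
rewrite (double_eq x y); apply: close_trans (close_orth pq) _.
rewrite mulr2n addrACA.
by apply: closeD; [exact: close_orth|exact: close_orthB].
Qed.

(** With p = x + y and q = x - y, orthogonal additivity splits each of f (2x),
    f (- 2x), f (2y), f (- 2y) over a signed pair of diagonals, and both sides
    become the sum of f over p, q, - p, - q. *)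
Lemma close_even_part x y : diagonal_pair x y ->
  close (4 * eps) (f (x *+ 2) + f (- (x *+ 2))) (f (y *+ 2) + f (- (y *+ 2))).
Proof.
case=> xy pq; have -> : 4 * eps = (eps + eps) + (eps + eps) by ring.
set p := x + y; set q := x - y.
apply: (@close_trans ((f p + f q) + (f (- p) + f (- q)))).
  rewrite (double_eq x y) opprD -/p -/q.
  by apply: closeD; [exact: close_orth|apply/close_orthB/perpNl].
have -> : y *+ 2 = p - q by rewrite (double_eq y x) (addrC y) opprB.
rewrite (opprB p q) (addrC q) [f (- p) + _]addrC addrACA [f q + _]addrC.
apply: closeD; apply: close_sym; first exact: close_orthB.
exact/close_orth/perpNl.
Qed.

(** Let (x, y) be a diagonal pair with w = 2x, let v = 2y, and put
    E = f v + f (- v). Then close_double for (w, v) and for its opposite gives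
    f (2w) ~ 2 f w + E and f (- 2w) ~ 2 f (- w) + E, while close_even_part for
    (x, y) gives f w + f (- w) ~ E. Hence
    8 f w + f (- 2w) ~ 6 f w + 2 (f w + f (- w)) + E ~ 6 f w + 3 E ~ 3 f (2w),
    with successive errors 3 eps, 2^beta 4 eps and 3^beta 3 eps. *)
Lemma nrm_doubling_defect (w : X) : double_set X w ->
  nrm (doubling_defect f w) <= defect_const beta * eps.
Proof.
case=> x _ <-; case: (perpP.2 x) => y /= xy.
have := diagonal_pair_double xy.
set u := x *+ 2; set v := y *+ 2 => uv.
pose E := f v + f (- v).
have fu := close_double uv.
have fNu : close (3 * eps) (f (- u *+ 2)) (f (- u) *+ 2 + E).
  have := close_double (diagonal_pairN uv).
  by rewrite (opprK v) (addrC (f (- v))).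
rewrite /doubling_defect -mulNrn.
rewrite (_ : _ - _ + _ = f u *+ 8 + f (- u *+ 2) - f (u *+ 2) *+ 3); last first.
  by rewrite addrAC.
change (close (defect_const beta * eps)
  (f u *+ 8 + f (- u *+ 2)) (f (u *+ 2) *+ 3)).
have -> : defect_const beta * eps = (0 + 3 * eps) +
    ((0 + 2%:R `^ beta * (4 * eps) + 0) + 3%:R `^ beta * (3 * eps)).
  by rewrite defect_constE//; ring.
apply: (close_trans (closeD (close_refl _) fNu)).
apply: (@close_trans (f u *+ 6 + E *+ 2 + E)); last first.
  rewrite -addrA -mulrSr (mulrnA _ 2 3) -mulrnDl.
  exact/close_sym/closeMn.
have -> : f u *+ 8 + (f (- u) *+ 2 + E) = f u *+ 6 + (f u + f (- u)) *+ 2 + E.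
  by rewrite (mulrnDr (f u) 6 2) mulrnDl !addrA.
apply: closeD (close_refl _); apply: closeD (close_refl _) _.
exact/closeMn/close_even_part.
Qed.
Definition step_const : R := defect_const beta * eps / 8 `^ beta.

Lemma double_setN (w : X) : double_set X w -> double_set X (- w).
Proof. by case=> x _ <-; exists (- x) => //; rewrite mulNrn. Qed.

Lemma double_setMn (w : X) n : double_set X w -> double_set X (w *+ n).
Proof. by case=> x _ <-; exists (x *+ n) => //; rewrite mulrnAC. Qed.

(** Stated with 2^n x in 2X so as to cover both doubles x with all n, for the
    distance from f, and arbitrary x with n > 0, for the existence of the
    limit. *)
Lemma nrm_renorm_step x n : double_set X (x *+ 2 ^ n) ->
  nrm (renorm f n x - renorm f n.+1 x) <= weight_term beta n * step_const.
Proof.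
have eighth (w : X) : double_set X w ->
    nrm (8^-1 *: doubling_defect f w) <= step_const.
  move=> w2; rewrite nrm_hom scalar_absV (scalar_abs_natr _ _ 8).
  rewrite -powR_inv1// -powRrM mulN1r powRN mulrC.
  rewrite ler_wpM2r ?invr_ge0 ?powR_ge0//.
  exact: nrm_doubling_defect.
by move=> w2; rewrite renorm_step; apply: nrm_weights; apply: eighth => //;
  exact: double_setN.
Qed.

Lemma nrm_renorm_additive x y n : perp x y ->
  nrm (renorm f n (x + y) - renorm f n x - renorm f n y)
    <= weight_term beta n * eps.
Proof.
move=> /(perp_double n) xy; rewrite renorm_cauchy_diff.
by apply: nrm_weights; apply: f_add => //; apply/perpNl/perpNr.
Qed.

End ApproximatelyAdditive.

End HomogeneousFnorm.

(** * Limits in an F-norm *)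

Section Limits.
Variables (R : realType) (k : scalar_kind) (Y : lmodType (scalars R k)).
Variables (nrm : Y -> R).
Hypothesis nrm_Fnorm : is_Fnorm nrm.

Let nrm_ge0 u : 0 <= nrm u. Proof. exact: Fnorm_ge0. Qed.
Let nrmD u v : nrm (u + v) <= nrm u + nrm v. Proof. exact: Fnorm_triangle. Qed.

Lemma nrm_telescope (s : nat -> Y) (S : nat -> R) n m : (n <= m)%N ->
  (forall i, (n <= i)%N -> nrm (s i - s i.+1) <= S i.+1 - S i) ->
  nrm (s n - s m) <= S m - S n.
Proof.
move=> + step; elim: m => [|m IHm].
  by rewrite leqn0 => /eqP ->; rewrite !subrr nrm0.
rewrite leq_eqVlt ltnS => /predU1P[-> |nm]; first by rewrite !subrr nrm0.
rewrite -(subrKA (s m)) -(subrKA (S m)) addrC (addrC (S m.+1 - _)).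
rewrite (le_trans (nrmD _ _))// addrC lerD ?IHm// step//.
Qed.

Lemma Fcauchy_telescope (s : nat -> Y) (S : nat -> R) N :
  nondecreasing_seq S -> cvgn S ->
  (forall i, (N <= i)%N -> nrm (s i - s i.+1) <= S i.+1 - S i) ->
  Fcauchy nrm s.
Proof.
move=> S_nd S_cvg step e e0.
have e2 : 0 < e / 2 by rewrite divr_gt0.
have [N' _ SN'] : \forall n \near \oo, limn S - S n < e / 2.
  have /cvgrPdist_lt/(_ _ e2) : S n @[n --> \oo] --> limn S by [].
  by apply: filterS => n; apply: le_lt_trans; exact: ler_norm.
pose M := maxn N N'.
have half m : (M <= m)%N -> nrm (s M - s m) < e / 2.
  move=> Mm; apply: le_lt_trans (SN' M (leq_maxr _ _)).
  apply: (@le_trans _ _ (S m - S M)).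
    apply: nrm_telescope => // i Mi; apply: step.
    exact: leq_trans (leq_maxl _ _) Mi.
  by rewrite lerB// nondecreasing_cvgn_le.
exists M => m n Mm Mn; rewrite -(subrKA (s M)) (splitr e).
by rewrite (le_lt_trans (nrmD _ _))// ltrD ?half// nrm_distC// half.
Qed.

Lemma le_cvg_right (u : nat -> R) (c l : R) :
  (forall n, c <= u n) -> u n @[n --> \oo] --> l -> c <= l.
Proof.
move=> cu ul; rewrite -(cvg_lim _ ul)//.
by apply: limr_ge; [exact: cvgP ul|exact: nearW].
Qed.

Lemma nrm_squeeze0 u (b : nat -> R) :
  (forall n, nrm u <= b n) -> b n @[n --> \oo] --> (0 : R) -> u = 0.
Proof.
move=> ub b0; apply: (nrm_eq0 nrm_Fnorm); apply/eqP.
by rewrite eq_le nrm_ge0 andbT (le_cvg_right ub b0).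
Qed.

End Limits.

(** * Existence and uniqueness of the orthogonally additive map *)

Section Stability.
Variables (R : realType) (k : scalar_kind) (Y : lmodType (scalars R k)).
Variables (nrm : Y -> R) (beta : R).
Hypotheses (nrm_Fnorm : is_Fnorm nrm) (beta_gt0 : 0 < beta).
Hypothesis nrm_hom : homogeneous_Fnorm beta nrm.
Variables (X : zmodType) (perp : X -> X -> Prop).
Hypothesis perpP : orthogonality_axioms perp.

Let partial_sum M n := series (weight_term beta) n * M.

Let partial_sumB M n :
  partial_sum M n.+1 - partial_sum M n = weight_term beta n * M.
Proof. by rewrite /partial_sum -mulrBl seriesSB. Qed.

Lemma step_const_ge0 (eps : R) : 0 <= eps -> 0 <= step_const beta eps.
Proof.
by move=> e0; rewrite divr_ge0 ?powR_ge0// mulr_ge0// defect_const_ge0.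
Qed.

Lemma nrm_dist_renorm (f : X -> Y) (eps : R) (x : X) n : 0 <= eps ->
  (forall x y, perp x y -> nrm (f (x + y) - f x - f y) <= eps) ->
  double_set X x -> nrm (f x - renorm f n x) <= stability_const beta * eps.
Proof.
move=> eps0 f_add x2; rewrite -{1}(renorm0 f x).
apply: (@le_trans _ _ (partial_sum (step_const beta eps) n -
                       partial_sum (step_const beta eps) 0)).
  apply: (nrm_telescope nrm_Fnorm (s := fun i => renorm f i x)
    (S := partial_sum (step_const beta eps))) => // i _; rewrite partial_sumB.
  apply: (nrm_renorm_step nrm_Fnorm nrm_hom perpP f_add).
  exact: double_setMn.
rewrite [partial_sum _ 0]/partial_sum [series _ 0]/series /=.
rewrite big_geq// mul0r subr0.
have -> : stability_const beta * eps =
    limn (series (weight_term beta)) * step_const beta eps.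
  by rewrite stability_constE// /step_const; ring.
rewrite ler_wpM2r ?step_const_ge0// nondecreasing_cvgn_le//.
  exact: weight_series_nd.
exact: is_cvg_weight_series.
Qed.

(** The case eps = 0 of the previous estimate: an orthogonally additive map is a
    fixed point of the renormalization on doubles. *)
Lemma orth_additive_renorm (g : X -> Y) (x : X) n :
  orth_additive perp g -> double_set X x -> renorm g n x = g x.
Proof.
move=> g_add x2.
have g0 y z : perp y z -> nrm (g (y + z) - g y - g z) <= 0.
  by move=> /g_add ->; rewrite addrAC addrK subrr nrm0.
apply/esym/subr0_eq/(nrm_eq0 nrm_Fnorm)/eqP.
rewrite eq_le (Fnorm_ge0 nrm_Fnorm) andbT.
by have := nrm_dist_renorm n (lexx 0) g0 x2; rewrite mulr0.
Qed.

(** The limit exists on the whole of X, not only on doubles: the step estimate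
    is available from n = 1 on because 2^n x is then a double. *)
Lemma renorm_limit (f : X -> Y) (eps : R) : Fcomplete nrm -> 0 <= eps ->
  (forall x y, perp x y -> nrm (f (x + y) - f x - f y) <= eps) ->
  exists g : X -> Y, forall x, nrm (renorm f n x - g x) @[n --> \oo] --> (0 : R).
Proof.
move=> Y_complete eps0 f_add.
suff /choice[g fg] : forall x, exists l : Y,
    nrm (renorm f n x - l) @[n --> \oo] --> (0 : R) by exists g.
move=> x.
apply: Y_complete.
apply: (Fcauchy_telescope nrm_Fnorm
  (S := partial_sum (step_const beta eps)) (N := 1)).
- apply/nondecreasing_seqP => n; rewrite -subr_ge0 partial_sumB.
  by rewrite mulr_ge0 ?weight_term_ge0 ?step_const_ge0.
- apply: cvgP; apply: cvgM; last exact: cvg_cst.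
  exact: (is_cvg_weight_series beta_gt0).
- move=> [//|n] _; rewrite partial_sumB.
  apply: (nrm_renorm_step nrm_Fnorm nrm_hom perpP f_add).
  by exists (x *+ 2 ^ n) => //; rewrite -mulrnA expnSr.
Qed.

Lemma renorm_limit_additive (f g : X -> Y) (eps : R) :
  (forall x y, perp x y -> nrm (f (x + y) - f x - f y) <= eps) ->
  (forall x, nrm (renorm f n x - g x) @[n --> \oo] --> (0 : R)) ->
  orth_additive perp g.
Proof.
move=> f_add fg x y xy; apply: subr0_eq.
apply: (nrm_squeeze0 nrm_Fnorm (b := fun n =>
   nrm (renorm f n (x + y) - g (x + y)) + (weight_term beta n * eps +
   (nrm (renorm f n x - g x) + nrm (renorm f n y - g y))))).
  move=> n.
  have r_add := nrm_renorm_additive nrm_Fnorm nrm_hom perpP f_add n xy.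
  apply: (close_trans nrm_Fnorm (v := renorm f n (x + y))).
  by apply: (close_sym nrm_Fnorm); exact: lexx.
  apply: (close_trans nrm_Fnorm (v := renorm f n x + renorm f n y)).
    by rewrite /close opprD addrA.
  by apply: (closeD nrm_Fnorm); exact: lexx.
rewrite -[X in _ --> X]addr0; apply: cvgD; first exact: fg.
rewrite -[X in _ --> X]addr0; apply: cvgD; first exact: cvg_weight_termM.
by rewrite -[X in _ --> X]addr0; apply: cvgD; exact: fg.
Qed.

End Stability.

Theorem theorem2p1 (R : realType) (k : scalar_kind)
  (X : zmodType) (perp : X -> X -> Prop)
  (Y : lmodType (scalars R k)) (nrm : Y -> R)
  (beta2 : R) (eps : R) (f : X -> Y)
  (hperp : orthogonality_axioms perp)
  (hbeta2 : 0 < beta2)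
  (hY : is_Fspace nrm)
  (hhom : homogeneous_Fnorm beta2 nrm)
  (heps : 0 <= eps)
  (hf : forall x y : X, perp x y -> nrm (f (x + y) - f x - f y) <= eps) :
  let good (g : X -> Y) : Prop :=
    orth_additive perp g /\
    (forall x : X, double_set X x ->
       nrm (f x - g x) <= stability_const beta2 * eps) in
  (exists g : X -> Y, good g) /\
  (forall g1 g2 : X -> Y, good g1 -> good g2 ->
     forall x : X, double_set X x -> g1 x = g2 x).
Proof.
case: hY => nrm_Fnorm Y_complete good; split.
  have [g fg] := renorm_limit nrm_Fnorm hbeta2 hhom hperp Y_complete heps hf.
  exists g; split.
    exact: (renorm_limit_additive nrm_Fnorm hbeta2 hhom hperp hf fg).
  move=> x x2.
  apply: (@le_cvg_right _ (fun n => stability_const beta2 * eps +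
                                    nrm (renorm f n x - g x))).
    move=> n; rewrite -(subrKA (renorm f n x)).
    apply: le_trans (Fnorm_triangle nrm_Fnorm _ _) _; rewrite lerD2r.
    exact: (nrm_dist_renorm nrm_Fnorm hbeta2 hhom hperp n heps hf x2).
  by rewrite -[X in _ --> X]addr0; apply: cvgD; [exact: cvg_cst|exact: fg].
move=> g1 g2 [g1_add g1_near] [g2_add g2_near] x x2; apply: subr0_eq.
(* The renormalizations fix g1 and g2 on doubles, but shrink their bounded
   difference to 0. *)
pose b := stability_const beta2 * eps.
have near12 w : double_set X w -> nrm (g1 w - g2 w) <= b + b.
  move=> w2; rewrite -(subrKA (f w)).
  apply: le_trans (Fnorm_triangle nrm_Fnorm _ _) _.
  by rewrite nrm_distC// lerD ?g1_near ?g2_near.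
apply: (nrm_squeeze0 nrm_Fnorm (b := fun n => weight_term beta2 n * (b + b))).
  move=> n.
  rewrite -(orth_additive_renorm nrm_Fnorm hbeta2 hhom hperp n g1_add x2).
  rewrite -(orth_additive_renorm nrm_Fnorm hbeta2 hhom hperp n g2_add x2).
  have w2 := double_setMn (2 ^ n) x2.
  rewrite renormB; apply: (nrm_weights nrm_Fnorm hhom); apply: near12 => //.
  exact: double_setN.
exact: cvg_weight_termM.
Qed.
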